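(* Let $\alpha_1,\dots,\alpha_n\in\mathbb{Q}^d$ be linearly independent and let $K=\mathscr{C}(\alpha_1,\dots,\alpha_n)=\{\sum_{i=1}^n k_i\alpha_i : k_i\ge 0\}$. Let $1\le r\le n$, $k\in\{0,1,\dots,r\}$, and let $$\gamma=p_1\alpha_1+\cdots+p_k\alpha_k-p_{k+1}\alpha_{k+1}-\cdots-p_r\alpha_r,$$ where $p_i\in\mathbb{Q}_{>0}$ for all $i$. For $1\le i\le k$ let $A_i$ be the matrix with columns $(-\alpha_1,\dots,-\alpha_{i-1},\gamma,\alpha_{i+1},\dots,\alpha_n)$, and for $k+1\le j\le r$ let $A_j$ be the matrix with columns $(\alpha_1,\dots,\alpha_k,-\alpha_{k+1},\dots,-\alpha_{j-1},-\gamma,\alpha_{j+1},\dots,\alpha_n)$. Then, as rational functions, $$\sigma(K)=\sum_{i=1}^{k}(-1)^{i-1}\sigma(\mathscr{C}(A_i))+\sum_{j=k+1}^{r}(-1)^{j-(k+1)}\sigma(\mathscr{C}(A_j)).$$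
   Context: For $S\subset\mathbb{R}^d$, the lattice-point generating function is $\sigma(S;\mathbf{y})=\sum_{\mathbf{m}\in S\cap\mathbb{Z}^d}\mathbf{y}^{\mathbf{m}}$ with $\mathbf{y}^{\mathbf{m}}=\prod_i y_i^{m_i}$. For rational polyhedra $S$, $\sigma(S)$ is identified with the rational function it represents (the Lawrence–Khovanskii–Pukhlikov valuation), so that $\sigma$ is additive on disjoint unions of rational polyhedra and $\sigma(P)=0$ whenever the rational polyhedron $P$ contains a line; all equalities between $\sigma$'s are equalities of rational functions. For a matrix $B$ with columns $\beta_1,\dots,\beta_n$, $\mathscr{C}(B)=\{\sum_i k_i\beta_i: k_i\ge 0\}$. *)

(* Defs.v *)
From mathcomp Require Import all_boot all_order all_algebra.
From mathcomp Require Import boolp classical_sets reals.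
From mathcomp Require Import ssrcomplements mpoly.

Set Implicit Arguments.
Unset Strict Implicit.
Unset Printing Implicit Defensive.

Import Order.TTheory GRing.Theory Num.Theory.
Local Open Scope ring_scope.

Definition ratfun (d : nat) : fieldType := {fraction {mpoly rat[d]}}.

Definition mk_ratfun (d : nat) (p q : {mpoly rat[d]}) : ratfun d :=
  FracField.tofrac p / FracField.tofrac q.

(* A family of coefficients a : 'cV[int]_d -> rat stands for the formal
   Laurent series \sum_m a(m) y^m, infinite in all directions; such series form
   a module over the polynomials. *)

Definition mnm_col (d : nat) (u : 'X_{1..d}) : 'cV[int]_d :=
  \col_i (u i)%:Z.

Definition series_of_poly (d : nat) (p : {mpoly rat[d]})
    (m : 'cV[int]_d) : rat :=
  \sum_(u <- msupp p) p@_u * (m == mnm_col u)%:R.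

Definition series_mul (d : nat) (q : {mpoly rat[d]}) (a : 'cV[int]_d -> rat)
    (m : 'cV[int]_d) : rat :=
  \sum_(u <- msupp q) q@_u * a (m - mnm_col u).

Definition lattice_series (R : realType) (d : nat) (S : set 'cV[R]_d)
    (m : 'cV[int]_d) : rat :=
  (`[< S (map_mx intr m) >])%:R.

(* The formal series of S represents f when f = p / q and q times the series is
   p.  Laurent numerators and denominators would give the same relation: both
   can be multiplied by a common monomial.  The relation is functional in f
   (represents_uniq), additive (represents_setU), and sends a set with a lattice
   period, e.g. a rational polyhedron containing a line, to 0
   (represents_period). *)
Definition represents (R : realType) (d : nat) (S : set 'cV[R]_d)
    (f : ratfun d) : Prop :=
  exists p q : {mpoly rat[d]},
    [/\ q != 0,
        forall m, series_mul q (lattice_series S) m = series_of_poly p m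
      & f = mk_ratfun p q].

(* The default value 0 is used only if S represents no rational function, which
   does not happen for rational polyhedra. *)
Definition sigma (R : realType) (d : nat) (S : set 'cV[R]_d) : ratfun d :=
  xget 0 (represents S).

Definition cone (R : realType) (d n : nat) (B : 'I_n -> 'cV[rat]_d) :
    set 'cV[R]_d :=
  [set x | exists2 k : 'I_n -> R, (forall i, 0 <= k i) &
           x = \sum_i k i *: map_mx ratr (B i)].
Arguments cone R {d n} B _.

(* alpha_1, ..., alpha_n, and likewise p_i and A_i, are stored at the indices
   0, ..., n-1, so that 1 <= i <= k reads i < k and k+1 <= j <= r reads
   k <= j < r. *)

Definition gamma (d n : nat) (alpha : 'I_n -> 'cV[rat]_d) (p : 'I_n -> rat)
    (k r : nat) : 'cV[rat]_d :=
  \sum_(i < n | (i < k)%N) p i *: alpha i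
  - \sum_(i < n | (k <= i < r)%N) p i *: alpha i.

Definition A_pos (d n : nat) (alpha : 'I_n -> 'cV[rat]_d) (g : 'cV[rat]_d)
    (i : 'I_n) : 'I_n -> 'cV[rat]_d :=
  fun l => if (l < i)%N then - alpha l
           else if l == i then g
           else alpha l.

Definition A_neg (d n : nat) (alpha : 'I_n -> 'cV[rat]_d) (g : 'cV[rat]_d)
    (k : nat) (j : 'I_n) : 'I_n -> 'cV[rat]_d :=
  fun l => if (l < k)%N then alpha l
           else if (l < j)%N then - alpha l
           else if l == j then - g
           else alpha l.

Lemma mnm_col_inj (d : nat) : injective (@mnm_col d).
Proof.
move=> u v /matrixP uv; apply/mnmP => i.
by have := uv i ord0; rewrite !mxE => -[].
Qed.

Lemma mnm_colD (d : nat) (u v : 'X_{1..d}) :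
  mnm_col (u + v)%MM = mnm_col u + mnm_col v.
Proof. by apply/matrixP => i j; rewrite !mxE mnmDE PoszD. Qed.

Lemma series_mulw (d k : nat) (q : {mpoly rat[d]}) a m : (msize q <= k)%N ->
  series_mul q a m = \sum_(u : 'X_{1..d < k}) q@_u * a (m - mnm_col u).
Proof.
move=> qk; pose I : subFinType _ := 'X_{1..d < k}.
rewrite /series_mul (big_mksub I) /=; first last.
- by move=> x /msize_mdeg_lt /leq_trans; apply.
- by rewrite msupp_uniq.
by rewrite big_rmcond //= => i; move/memN_msupp_eq0 ->; rewrite mul0r.
Qed.

Lemma series_mulDl (d : nat) (p q : {mpoly rat[d]}) a m :
  series_mul (p + q) a m = series_mul p a m + series_mul q a m.
Proof.
pose k := maxn (msize (p + q)) (maxn (msize p) (msize q)).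
rewrite !(@series_mulw d k) ?leq_max ?leqnn ?orbT // -big_split /=.
by apply: eq_bigr => u _; rewrite mcoeffD mulrDl.
Qed.

Lemma series_mulZl (d : nat) c (q : {mpoly rat[d]}) a m :
  series_mul (c *: q) a m = c * series_mul q a m.
Proof.
pose k := maxn (msize (c *: q)) (msize q).
rewrite !(@series_mulw d k) ?leq_max ?leqnn ?orbT // mulr_sumr.
by apply: eq_bigr => u _; rewrite mcoeffZ mulrA.
Qed.

Lemma series_mul0l (d : nat) a (m : 'cV[int]_d) : series_mul 0 a m = 0.
Proof. by rewrite /series_mul msupp0 big_nil. Qed.

Lemma series_mulX (d : nat) (u : 'X_{1..d}) a m :
  series_mul 'X_[u] a m = a (m - mnm_col u).
Proof. by rewrite /series_mul msuppX big_seq1 mcoeffX eqxx mul1r. Qed.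

Lemma series_mul_suml (d : nat) (I : Type) (r : seq I)
    (F : I -> {mpoly rat[d]}) a m :
  series_mul (\sum_(i <- r) F i) a m = \sum_(i <- r) series_mul (F i) a m.
Proof.
elim: r => [|i r IH]; first by rewrite !big_nil series_mul0l.
by rewrite !big_cons series_mulDl IH.
Qed.

Lemma series_mulA (d : nat) (p q : {mpoly rat[d]}) a m :
  series_mul (p * q) a m = series_mul p (series_mul q a) m.
Proof.
rewrite mpolyME series_mul_suml big_allpairs; apply: eq_bigr => u _.
rewrite mulr_sumr; apply: eq_bigr => v _ /=.
by rewrite series_mulZl series_mulX mnm_colD opprD addrA mulrA.
Qed.

Lemma series_mulDr (d : nat) (q : {mpoly rat[d]}) a b m :
  series_mul q (fun x => a x + b x) m = series_mul q a m + series_mul q b m.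
Proof. by rewrite -big_split; apply: eq_bigr => u _; rewrite mulrDr. Qed.

Lemma series_of_polyE (d : nat) (p : {mpoly rat[d]}) m :
  series_of_poly p m = series_mul p (fun x => (x == 0)%:R) m.
Proof. by apply: eq_bigr => u _; rewrite subr_eq0. Qed.

Lemma series_of_polyM (d : nat) (p q : {mpoly rat[d]}) m :
  series_of_poly (p * q) m = series_mul p (series_of_poly q) m.
Proof.
rewrite series_of_polyE series_mulA.
by apply: eq_bigr => u _; rewrite series_of_polyE.
Qed.

Lemma series_of_poly_inj (d : nat) (p q : {mpoly rat[d]}) :
  (forall m, series_of_poly p m = series_of_poly q m) -> p = q.
Proof.
have coefE (s : {mpoly rat[d]}) u : series_of_poly s (mnm_col u) = s@_u.
  transitivity (\sum_(v <- msupp s) s@_v *: 'X_[v])@_u; last by rewrite -mpolyE.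
  rewrite raddf_sum /=; apply: eq_bigr => v _.
  by rewrite mcoeffZ mcoeffX (inj_eq (@mnm_col_inj d)) eq_sym.
by move=> pq; apply/mpolyP => u; rewrite -!coefE.
Qed.

Lemma represents_uniq (R : realType) (d : nat) (S : set 'cV[R]_d)
    (f g : ratfun d) : represents S f -> represents S g -> f = g.
Proof.
move=> [p [q [q0 qp ->]]] [p' [q' [q'0 qp' ->]]].
apply/eqP; rewrite /mk_ratfun eqr_div ?tofrac_eq0 //.
rewrite -!tofracM tofrac_eq; apply/eqP/series_of_poly_inj => m.
rewrite mulrC series_of_polyM.
transitivity (series_mul (q' * q) (lattice_series S) m).
  by rewrite series_mulA; apply: eq_bigr => u _; rewrite qp.
rewrite mulrC series_mulA [p' * q]mulrC series_of_polyM.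
by apply: eq_bigr => u _; rewrite qp'.
Qed.

Lemma sigma_eq (R : realType) (d : nat) (S : set 'cV[R]_d) (f : ratfun d) :
  represents S f -> sigma S = f.
Proof.
by move=> Sf; apply: xget_unique => // g Sg; apply: represents_uniq Sg Sf.
Qed.

Lemma represents_setU (R : realType) (d : nat) (S T : set 'cV[R]_d)
    (f g : ratfun d) :
  (S `&` T = set0)%classic -> represents S f -> represents T g ->
  represents (S `|` T)%classic (f + g).
Proof.
move=> ST [p [q [q0 qp ->]]] [p' [q' [q'0 qp' ->]]].
exists (q' * p + q * p'), (q * q'); split; first by rewrite mulf_neq0.
- move=> m.
  have -> : lattice_series (S `|` T)%classic
      = (fun x => lattice_series S x + lattice_series T x).
    apply: funext => x; rewrite /lattice_series.
    rewrite asbool_or; case: asboolP => Sx; case: asboolP => Tx //=.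
    by have : set0 (map_mx intr x : 'cV[R]_d) by rewrite -ST.
  rewrite series_mulDr [RHS]series_of_polyE series_mulDl -!series_of_polyE.
  rewrite !series_of_polyM; congr (_ + _).
    by rewrite mulrC series_mulA; apply: eq_bigr => u _; rewrite qp.
  by rewrite series_mulA; apply: eq_bigr => u _; rewrite qp'.
rewrite [q' * p]mulrC [q * p']mulrC /mk_ratfun addf_div ?tofrac_eq0 //.
by rewrite tofracD !tofracM.
Qed.

Lemma represents_period (R : realType) (d : nat) (S : set 'cV[R]_d)
    (v : 'cV[int]_d) :
  v != 0 -> (forall x, S (x + map_mx intr v) <-> S x) -> represents S 0.
Proof.
move=> v0 Sv.
pose up : 'X_{1..d} :=
  [multinom if (0 <= v i ord0)%R then `|v i ord0|%N else 0%N | i < d].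
pose un : 'X_{1..d} :=
  [multinom if (0 <= v i ord0)%R then 0%N else `|v i ord0|%N | i < d].
have vE : v = mnm_col up - mnm_col un.
  apply/matrixP => i j; rewrite !mxE !mnmE (ord1 j).
  case: (lerP 0 (v i ord0)) => h; first by rewrite subr0 gez0_abs.
  by rewrite sub0r ltz0_abs // opprK.
exists 0, ('X_[up] - 'X_[un]); split.
- apply: contraNneq v0 => /eqP; rewrite subr_eq0 => /eqP h.
  suff -> : v = 0 by [].
  rewrite vE; suff -> : up = un by rewrite subrr.
  have := congr1 (fun p : {mpoly rat[d]} => p@_up) h.
  rewrite !mcoeffX eqxx; case: (eqVneq un up) => [-> //|_] /eqP.
  by rewrite oner_eq0.
- move=> m; rewrite series_of_polyE series_mul0l -scaleN1r.
  rewrite series_mulDl series_mulZl !series_mulX mulN1r /lattice_series.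
  apply/eqP; rewrite subr_eq0; apply/eqP; congr (_%:R); congr nat_of_bool.
  apply: asbool_equiv_eq; rewrite -Sv -map_mxD.
  by rewrite (_ : m - mnm_col up + v = m - mnm_col un) // vE addrA subrK.
by rewrite /mk_ratfun tofrac0 mul0r.
Qed.

(* Main.v *)
Require Import Defs.
From mathcomp Require Import all_boot all_order all_algebra.
From mathcomp Require Import boolp classical_sets reals.
From mathcomp Require Import mpoly.
From mathcomp Require Import ring lra.

Set Implicit Arguments.
Unset Strict Implicit.
Unset Printing Implicit Defensive.

Import Order.TTheory GRing.Theory Num.Theory.
Local Open Scope ring_scope.

(* In the coordinates c of a point with respect to alpha, put t_l = c_l / p_l for
   l <= r.  Modulo sets with a lattice period, reversing an inequality
   [0 <= x_l] on one coordinate of a simplicial cone into [x_l < 0] only changes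
   the sign of its generating function.  Reversing in this way every generator
   that occurs as [- alpha_l] absorbs the sign of the i-th term and turns the
   cone of A_i, i <= k, into the cell where t_i is the first minimum of
   t_1, ..., t_k, with t_i >= 0 and t_l + t_i >= 0 for k < l <= r; likewise for
   A_j.  With m and m' the minima of t over the two index ranges, the cells of
   the first kind fill {m >= 0, m + m' >= 0} and those of the second kind
   {m' >= 0, m + m' >= 0}.  Together they count K once, plus once the set
   {m + m' >= 0}, which is invariant under translation by gamma.  If k = 0 or
   k = r there is only one kind of cell, and the cells fill K. *)

(** * Rational functions represented by coefficient families *)

(** This is [represents] for an arbitrary coefficient family instead of an indicator, so that
    differences and signed sums of indicators are covered. *)
Definition series_represents (d : nat) (a : 'cV[int]_d -> rat)
    (f : ratfun d) : Prop :=
  exists p q : {mpoly rat[d]},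
    [/\ q != 0, forall m, series_mul q a m = series_of_poly p m
      & f = mk_ratfun p q].

Lemma series_mulC (d : nat) (p q : {mpoly rat[d]}) a m :
  series_mul p (series_mul q a) m = series_mul q (series_mul p a) m.
Proof. by rewrite -!series_mulA mulrC. Qed.

Lemma eq_series_mul (d : nat) (q : {mpoly rat[d]}) a b :
  a =1 b -> series_mul q a =1 series_mul q b.
Proof. by move=> ab m; apply: eq_bigr => u _; rewrite ab. Qed.

Lemma series_represents_ext (d : nat) (a b : 'cV[int]_d -> rat) f :
  a =1 b -> series_represents a f -> series_represents b f.
Proof. by move=> /funext ->. Qed.

Lemma series_of_polyD (d : nat) (p q : {mpoly rat[d]}) m :
  series_of_poly (p + q) m = series_of_poly p m + series_of_poly q m.
Proof. by rewrite !series_of_polyE series_mulDl. Qed.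

Lemma series_of_polyZ (d : nat) c (p : {mpoly rat[d]}) m :
  series_of_poly (c *: p) m = c * series_of_poly p m.
Proof. by rewrite !series_of_polyE series_mulZl. Qed.

Lemma series_represents0 (d : nat) : series_represents (fun=> 0) (0 : ratfun d).
Proof.
exists 0, 1; split=> [|m|]; first exact: oner_neq0.
  rewrite series_of_polyE series_mul0l /series_mul big1 // => u _.
  by rewrite mulr0.
by rewrite /mk_ratfun tofrac0 mul0r.
Qed.

Lemma series_representsD (d : nat) (a b : 'cV[int]_d -> rat) f g :
  series_represents a f -> series_represents b g ->
  series_represents (fun m => a m + b m) (f + g).
Proof.
move=> [p [q [q0 qa ->]]] [p' [q' [q'0 qb ->]]].
exists (p * q' + p' * q), (q * q'); split; first by rewrite mulf_neq0.
- move=> m; rewrite series_mulDr series_of_polyD; congr (_ + _).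
    by rewrite mulrC series_mulA (eq_series_mul _ qa) -series_of_polyM mulrC.
  by rewrite series_mulA (eq_series_mul _ qb) -series_of_polyM mulrC.
by rewrite /mk_ratfun addf_div ?tofrac_eq0 // tofracD !tofracM.
Qed.

Lemma series_representsN (d : nat) (a : 'cV[int]_d -> rat) f :
  series_represents a f -> series_represents (fun m => - a m) (- f).
Proof.
move=> [p [q [q0 qa ->]]]; exists (- p), q; split=> //.
- move=> m; rewrite -scaleN1r series_of_polyZ mulN1r -qa /series_mul -sumrN.
  by apply: eq_bigr => u _; rewrite mulrN.
by rewrite /mk_ratfun tofracN mulNr.
Qed.

Lemma series_represents_sum (d : nat) (I : Type) (s : seq I) (P : pred I)
    (a : I -> 'cV[int]_d -> rat) (f : I -> ratfun d) :
  (forall i, P i -> series_represents (a i) (f i)) ->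
  series_represents (fun m => \sum_(i <- s | P i) a i m)
                    (\sum_(i <- s | P i) f i).
Proof.
move=> af; elim: s => [|i s IH].
  rewrite big_nil; apply: series_represents_ext (series_represents0 d) => m.
  by rewrite big_nil.
rewrite big_cons; case Pi: (P i); last first.
  by apply: series_represents_ext IH => m; rewrite big_cons Pi.
apply: series_represents_ext (series_representsD (af i Pi) IH) => m.
by rewrite big_cons Pi.
Qed.

Lemma series_represents_divl (d : nat) (q : {mpoly rat[d]}) a f :
  q != 0 -> series_represents (series_mul q a) f ->
  series_represents a (f / FracField.tofrac q).
Proof.
move=> q0 [p [q' [q'0 qa ->]]]; exists p, (q' * q); split.
- by rewrite mulf_neq0.
- by move=> m; rewrite series_mulA qa.
by rewrite /mk_ratfun tofracM invfM mulrA.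
Qed.

Lemma series_represents_mull (d : nat) (q : {mpoly rat[d]}) a f :
  series_represents a f ->
  series_represents (series_mul q a) (FracField.tofrac q * f).
Proof.
move=> [p [q' [q'0 qa ->]]]; exists (q * p), q'; split=> //.
  by move=> m; rewrite series_mulC (eq_series_mul _ qa) series_of_polyM.
by rewrite /mk_ratfun tofracM mulrA.
Qed.

(* Multiplying by [y^un - y^up], where [v = up - un], instead of [1 - y^v] keeps
   the denominator polynomial. *)
Lemma series_represents_diff (d : nat) (v : 'cV[int]_d) : v != 0 ->
  exists u : ratfun d, forall a f,
    series_represents (fun m => a m - a (m - v)) f ->
    series_represents a (u * f).
Proof.
move=> v0.
pose up : 'X_{1..d} :=
  [multinom if (0 <= v i ord0)%R then `|v i ord0|%N else 0%N | i < d].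
pose un : 'X_{1..d} :=
  [multinom if (0 <= v i ord0)%R then 0%N else `|v i ord0|%N | i < d].
have vE : v = mnm_col up - mnm_col un.
  apply/matrixP => i j; rewrite !mxE !mnmE (ord1 j).
  case: (lerP 0 (v i ord0)) => h; first by rewrite subr0 gez0_abs.
  by rewrite sub0r ltz0_abs // opprK.
pose q : {mpoly rat[d]} := 'X_[un] - 'X_[up].
have q0 : q != 0.
  apply: contraNneq v0 => /eqP; rewrite subr_eq0 => /eqP h.
  rewrite vE; suff -> : up = un by rewrite subrr.
  have := congr1 (fun p : {mpoly rat[d]} => p@_up) h.
  rewrite !mcoeffX eqxx; case: (eqVneq un up) => [-> //|_] /eqP.
  by rewrite eq_sym oner_eq0.
(* This factor is [1 / (1 - y^v)], because [q = y^un (1 - y^v)]. *)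
exists ((FracField.tofrac q)^-1 * FracField.tofrac 'X_[un]) => a f.
move=> /(series_represents_mull 'X_[un]) af.
rewrite -mulrA mulrC; apply: series_represents_divl q0 _.
apply: series_represents_ext af => m; rewrite series_mulX /q.
rewrite -['X_[up]]scale1r -scaleNr series_mulDl series_mulZl !series_mulX mulN1r.
congr (_ - a _).
by rewrite vE opprB addrA subrK.
Qed.

(** The support lies in the box [[-N, N]^d], so multiplication by [y^(N, ..., N)] turns the series
    into a polynomial. *)
Lemma series_represents_finite (d : nat) (a : 'cV[int]_d -> rat) (N : nat) :
  (forall m, a m != 0 -> forall i, `|m i 0| <= N%:Z) ->
  exists f, series_represents a f.
Proof.
move=> aN; pose u : 'X_{1..d} := [multinom N | i < d].
pose q : {mpoly rat[d]} := 'X_[u].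
have q0 : q != 0 by rewrite -msize_poly_eq0 msizeX.
pose w (h : {ffun 'I_d -> 'I_(N + N).+1}) : 'X_{1..d} := [multinom h i : nat | i < d].
pose p : {mpoly rat[d]} := \sum_h a (mnm_col (w h) - mnm_col u) *: 'X_[w h].
exists (mk_ratfun p q), p, q; split=> // m.
rewrite series_mulX series_of_polyE series_mul_suml.
under eq_bigr => h _ do rewrite series_mulZl series_mulX subr_eq0.
have [/eqP am0|am0] := boolP (a (m - mnm_col u) == 0).
  rewrite am0 big1 // => h _; case: eqP => [mw|_]; last by rewrite mulr0.
  by rewrite -mw am0 mul0r.
have mN i : (0 <= m i 0 <= (N + N)%:Z)%R.
  have := aN _ am0 i; rewrite !mxE mnmE ler_norml PoszD.
  by rewrite lerBlDr lerBrDr addNr.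
pose h0 : {ffun 'I_d -> 'I_(N + N).+1} := [ffun i => inord (absz (m i 0))].
have mh0 : m = mnm_col (w h0).
  apply/matrixP => i j; rewrite (ord1 j) !mxE mnmE ffunE.
  have /andP[m0 mNi] := mN i.
  by rewrite inordK ?gez0_abs // ltnS -lez_nat gez0_abs.
rewrite (bigD1 h0) //= -mh0 eqxx mulr1 big1 ?addr0 // => h hh0.
case: eqP => [mw|_]; last by rewrite mulr0.
case/eqP: hh0; apply/ffunP => i; apply/val_inj.
have := mw; rewrite {1}mh0 => /mnm_col_inj /mnmP /(_ i).
by rewrite !mnmE => /esym.
Qed.

(** * Series in the coordinates of a basis *)

(** Supplies lattice vectors along rational directions, since a formal series can only be translated
    by integer vectors. *)
Lemma clear_denominators (m n : nat) (A : 'M[rat]_(m, n)) :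
  exists (N : nat) (V : 'M[int]_(m, n)),
    (0 < N)%N /\ map_mx intr V = N%:R *: A.
Proof.
pose N := (\prod_i \prod_j `|denq (A i j)|)%N.
exists N, (\matrix_(i, j) (numq (A i j) * (N %/ `|denq (A i j)|)%:Z)); split.
  by do 2!apply: prodn_gt0 => ?; rewrite absz_gt0 denq_neq0.
apply/matrixP => i j; rewrite !mxE rmorphM /=.
have dN : (`|denq (A i j)| %| N)%N.
  by rewrite /N (bigD1 i) //= (bigD1 j) //= -mulnA dvdn_mulr.
rewrite -[in RHS](divq_num_den (A i j)) mulrCA; congr (_ * _).
have dE : (denq (A i j))%:~R = `|denq (A i j)|%N%:R :> rat.
  by rewrite -[X in X%:~R]absz_denq.
rewrite dE -[in RHS](divnK dN) natrM mulfK // pnatr_eq0 absz_eq0.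
exact: denq_neq0.
Qed.

(* For [C] a left inverse of [M], the formal series with coefficient [F c] at the
   lattice points [M c] and [0] at those outside the column space of [M]. *)
Definition coord_series (d n : nat) (M : 'M[rat]_(d, n)) (C : 'M[rat]_(n, d))
    (F : 'cV[rat]_n -> rat) (m : 'cV[int]_d) : rat :=
  let x := map_mx intr m in (M *m (C *m x) == x)%:R * F (C *m x).

Lemma coord_series_ext (d n : nat) (M : 'M[rat]_(d, n)) C
    (F G : 'cV[rat]_n -> rat) :
  F =1 G -> coord_series M C F =1 coord_series M C G.
Proof. by move=> FG m; rewrite /coord_series FG. Qed.

Lemma coord_seriesD (d n : nat) (M : 'M[rat]_(d, n)) C
    (F G : 'cV[rat]_n -> rat) m :
  coord_series M C (fun c => F c + G c) m
  = coord_series M C F m + coord_series M C G m.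
Proof. exact: mulrDr. Qed.

Lemma coord_seriesN (d n : nat) (M : 'M[rat]_(d, n)) C
    (F : 'cV[rat]_n -> rat) m :
  coord_series M C (fun c => - F c) m = - coord_series M C F m.
Proof. exact: mulrN. Qed.

Lemma coord_series_sum (d n : nat) (M : 'M[rat]_(d, n)) C (I : Type) (s : seq I)
    (P : pred I) (F : I -> 'cV[rat]_n -> rat) m :
  coord_series M C (fun c => \sum_(i <- s | P i) F i c) m
  = \sum_(i <- s | P i) coord_series M C (F i) m.
Proof. exact: mulr_sumr. Qed.

Lemma coord_series_basis (d n : nat) (M : 'M[rat]_(d, n)) C
    (T U : 'M[rat]_n) (F : 'cV[rat]_n -> rat) :
  T *m U = 1%:M ->
  coord_series (M *m T) (U *m C) F =1 coord_series M C (fun c => F (U *m c)).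
Proof.
move=> TU m; rewrite /coord_series -!mulmxA; congr ((_ == _)%:R * _).
by rewrite [T *m _]mulmxA TU mul1mx.
Qed.

(** The vector [v] lies in the column space of [M], so translating by it preserves the membership
    test and moves the coordinates by [w]. *)
Lemma coord_series_shift (d n : nat) (M : 'M[rat]_(d, n)) C
    (F : 'cV[rat]_n -> rat) (v : 'cV[int]_d) (w : 'cV[rat]_n) m :
  C *m M = 1%:M -> map_mx intr v = M *m w ->
  coord_series M C F (m - v) = coord_series M C (fun c => F (c - w)) m.
Proof.
move=> CM vw; rewrite /coord_series map_mxB vw mulmxBr [C *m (M *m w)]mulmxA CM.
by rewrite mul1mx mulmxBr (inj_eq (addIr _)).
Qed.

(** Some positive multiple of [M *m w] is a lattice vector [v], and invariance says that [1 - y^v]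
    annihilates the series. *)
Lemma coord_series_period (d n : nat) (M : 'M[rat]_(d, n)) C
    (F : 'cV[rat]_n -> rat) (w : 'cV[rat]_n) :
  C *m M = 1%:M -> w != 0 -> (forall x c, F (c + x *: w) = F c) ->
  series_represents (coord_series M C F) 0.
Proof.
move=> CM w0 Fw; have [N [v [N0 vw]]] := clear_denominators (M *m w).
rewrite scalemxAr in vw.
have v0 : v != 0.
  apply: contraNneq w0 => v0; have := congr1 (mulmx C) vw.
  rewrite mulmxA CM mul1mx v0 map_mx0 mulmx0 => /esym/eqP.
  by rewrite scaler_eq0 pnatr_eq0 -[N == 0%N]negbK -lt0n N0.
(* Since the difference is [0], the value of the factor [u] does not matter. *)
have [u /(_ (coord_series M C F) 0)] := series_represents_diff v0.
rewrite mulr0; apply.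
apply: series_represents_ext (series_represents0 d) => m.
rewrite (coord_series_shift _ _ CM vw).
under [X in _ = _ - X]coord_series_ext => c do rewrite -scaleNr Fw.
by rewrite subrr.
Qed.

(** Bounded coordinates bound the lattice points: every entry of [M c] is at most [B] in absolute
    value. *)
Lemma coord_series_finite (d n : nat) (M : 'M[rat]_(d, n)) C
    (F : 'cV[rat]_n -> rat) (N : nat) :
  (forall c, F c != 0 -> forall l, `|c l 0| <= N%:R) ->
  exists f, series_represents (coord_series M C F) f.
Proof.
move=> FN; pose B := \sum_j \sum_l `|M j l| * N%:R.
have B0 : 0 <= B by do 2!apply: sumr_ge0 => ? _; apply: mulr_ge0.
apply: (@series_represents_finite _ _ (Num.bound B)) => m.
rewrite mulf_eq0 pnatr_eq0 eqb0 negb_or negbK => /andP[/eqP xM Fc] j.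
rewrite -(ler_int rat) intr_norm; apply/ltW/le_lt_trans/(archi_boundP B0).
have -> : (m j 0)%:~R = (map_mx intr m : 'cV[rat]_d) j 0 by rewrite mxE.
rewrite -xM mxE; apply: le_trans (ler_norm_sum _ _ _) _.
rewrite /B (bigD1 j) //= ler_wpDr //.
  by apply: sumr_ge0 => ? _; apply: sumr_ge0 => ? _; apply: mulr_ge0.
by apply: ler_sum => l _; rewrite normrM ler_wpM2l // FN.
Qed.

(** * Orthants and simplicial cones *)

Lemma prodr_bool (I : finType) (P b : pred I) :
  \prod_(i | P i) (b i)%:R = [forall (i | P i), b i]%:R :> rat.
Proof.
have [/forall_inP Pb|/forall_inPn[i Pi /negPf bi]] := boolP [forall (i | P i), b i].
  by rewrite big1 // => i /Pb ->.
by rewrite (bigD1 i) //= bi mul0r.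
Qed.

Definition orthant (n : nat) (c : 'cV[rat]_n) : rat :=
  \prod_l (0 <= c l 0)%R%:R.

(* Multiplying by [1 - y^v], with [v] a lattice vector on the l-th ray, cuts the
   orthant down to a slab; after all [n] multiplications a box is left. *)
Lemma series_represents_orthant (d n : nat) (M : 'M[rat]_(d, n)) C :
  C *m M = 1%:M ->
  exists f, series_represents (coord_series M C (@orthant n)) f.
Proof.
move=> CM; have [N [V [N0 VM]]] := clear_denominators M.
(* [F s] cuts off the first [s] coordinates at [N]: [F 0] is the orthant and [F n] a box. The
   induction goes from the box back to the orthant. *)
pose F s (c : 'cV[rat]_n) : rat :=
  \prod_l ((0 <= c l 0)%R && ((l < s)%N ==> (c l 0 < N%:R)%R))%:R.
suff /(_ n) [f Ff] : forall j, exists f,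
    series_represents (coord_series M C (F (n - j)%N)) f.
  exists f; apply: series_represents_ext Ff; apply: coord_series_ext => c.
  by apply: eq_bigr => l _; rewrite subnn ltn0 andbT.
elim=> [|j [f Ff]].
  apply: (@coord_series_finite _ _ M C _ N) => c.
  rewrite subn0 /F prodr_bool pnatr_eq0 eqb0 negbK => /forall_inP cN l.
  by have := cN l isT; rewrite ltn_ord /= => /andP[c0 /ltW]; rewrite ger0_norm.
(* For [n <= j] both truncated differences are [0]. *)
have [jn|nj] := ltnP j n; last first.
  by exists f; rewrite (eqP (leqW nj)); rewrite (eqP nj) in Ff.
have sn : (n - j.+1 < n)%N by rewrite ltn_subrL (leq_ltn_trans _ jn).
(* Coordinate [s] is the one cut off in [F (n - j)] but not in [F (n - j.+1)]. *)
pose s : 'I_n := Ordinal sn; pose w : 'cV[rat]_n := N%:R *: delta_mx s 0.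
have vw : map_mx intr (col s V) = M *m w.
  by rewrite map_col VM -scalemxAr -colE; apply/matrixP => i k; rewrite !mxE.
have w0 : w != 0.
  rewrite scaler_eq0 pnatr_eq0 negb_or -lt0n N0.
  apply/eqP => /matrixP/(_ s 0); rewrite !mxE !eqxx => /eqP.
  by rewrite oner_eq0.
have v0 : col s V != 0.
  apply: contraNneq w0 => v0; have := congr1 (mulmx C) vw.
  by rewrite mulmxA CM mul1mx v0 map_mx0 mulmx0 => <-.
have [u uP] := series_represents_diff v0.
exists (u * f); apply: uP; apply: series_represents_ext Ff => m.
rewrite (coord_series_shift _ _ CM vw) -coord_seriesN -coord_seriesD.
apply: coord_series_ext => {m} c; rewrite -(subnSK jn) -/(nat_of_ord s).
rewrite /F [LHS](bigD1 s) //= [X in _ = X - _](bigD1 s) //=.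
rewrite [X in _ = _ - X](bigD1 s) //= ltnn ltnSn /= !andbT.
pose P := \prod_(l | l != s)
  ((0 <= c l 0)%R && ((l < s)%N ==> (c l 0 < N%:R)%R))%:R : rat.
rewrite [X in _ * X = _](_ : _ = P); last first.
  apply: eq_bigr => l /negPf ls.
  by rewrite ltnS leq_eqVlt (_ : (nat_of_ord l == _) = false).
rewrite [X in _ = _ - _ * X](_ : _ = P); last first.
  by apply: eq_bigr => l /negPf ls; rewrite !mxE ls mulr0 subr0.
(* What remains is [[0 <= c_s < N] = [0 <= c_s] - [N <= c_s]]. *)
rewrite -/P -mulrBl !mxE !eqxx mulr1 subr_ge0; congr (_ * _).
case: (lerP N%:R (c s 0)) => [/(le_trans (ler0n _ N)) ->|_].
  by rewrite subrr.
by rewrite andbT subr0.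
Qed.

(** The left inverse forces the real coefficients of a lattice point [x] to be the rational vector
    [C *m x], so membership in the real cone is a sign test over the rationals. *)
Lemma lattice_series_cone (R : realType) (d n : nat) (B : 'I_n -> 'cV[rat]_d) M C :
  (forall l, B l = col l M) -> C *m M = 1%:M ->
  lattice_series (cone R B) =1 coord_series M C (@orthant n).
Proof.
move=> BM CM m; rewrite /lattice_series /coord_series /=.
rewrite /orthant prodr_bool -natrM mulnb; congr ((nat_of_bool _)%:R).
set x : 'cV[rat]_d := map_mx intr m.
have xR : map_mx ratr x = map_mx intr m :> 'cV[R]_d.
  by apply/matrixP => i j; rewrite !mxE ratr_int.
have combE (K : 'I_n -> R) :
    \sum_l K l *: map_mx ratr (B l) = map_mx ratr M *m \col_l K l.
  apply/matrixP => i j; rewrite !mxE summxE; apply: eq_bigr => l _.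
  by rewrite !mxE BM mxE mulrC.
apply/asboolP/andP => [[K K0]|[/eqP xM /forall_inP x0]].
  rewrite combE => xK.
  have KE : \col_l K l = map_mx ratr (C *m x).
    by rewrite map_mxM xR xK mulmxA -map_mxM CM map_mx1 mul1mx.
  split.
    apply/eqP; apply: (@map_mx_inj _ _ (@ratr R)).
    by rewrite map_mxM -KE -xK xR.
  apply/forall_inP => l _; rewrite -(ler0q R).
  by have := congr1 (fun c : 'cV[R]_n => c l 0) KE; rewrite !mxE => <-.
exists (fun l => ratr ((C *m x) l 0)) => [l|]; first by rewrite ler0q x0.
rewrite combE -xR -{1}xM map_mxM; congr (_ *m _).
by apply/matrixP => l j; rewrite (ord1 j) !mxE.
Qed.

(** * Reversing inequalities *)

(** [F + G] is invariant along [w], hence represents [0], and [G] is this sum minus [F]. *)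
Lemma coord_series_flip (d n : nat) (M : 'M[rat]_(d, n)) C
    (F G : 'cV[rat]_n -> rat) (w : 'cV[rat]_n) f :
  C *m M = 1%:M -> w != 0 ->
  (forall x c, F (c + x *: w) + G (c + x *: w) = F c + G c) ->
  series_represents (coord_series M C F) f ->
  series_represents (coord_series M C G) (- f).
Proof.
move=> CM w0 FG /series_representsN Ff.
have := series_representsD (coord_series_period CM w0 FG) Ff.
rewrite add0r; apply: series_represents_ext => m.
by rewrite coord_seriesD addrC addKr.
Qed.

(** One reversal per element [a] of [D]: the conditions [c_a < 0] and [0 <= c_a] together leave
    [c_a] free, which gives invariance along the [a]-th basis vector. *)
Lemma series_represents_flip_orthant (d n : nat) (M : 'M[rat]_(d, n)) C
    (D : {set 'I_n}) f :
  C *m M = 1%:M -> series_represents (coord_series M C (@orthant n)) f ->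
  series_represents (coord_series M C (fun c =>
      \prod_l (if l \in D then c l 0 < 0 else 0 <= c l 0)%R%:R))
    ((-1) ^+ #|D| * f).
Proof.
move=> CM Ff; elim: {D}#|D| {-2}D (erefl #|D|) => [|s IH] D.
  move=> /eqP; rewrite cards_eq0 => /eqP ->; rewrite cards0 mul1r.
  apply: series_represents_ext Ff; apply: coord_series_ext => c.
  by apply: eq_bigr => l _; rewrite inE.
move=> Ds; have /card_gt0P[a aD] : (0 < #|D|)%N by rewrite Ds.
have Da : #|D :\ a| = s by have := cardsD1 a D; rewrite aD Ds => -[].
rewrite Ds exprS mulN1r mulNr -Da.
apply: (@coord_series_flip _ _ _ _ _ _ (delta_mx a 0)) (IH _ Da) => //.
  apply/eqP => /matrixP/(_ a 0); rewrite !mxE !eqxx => /eqP.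
  by rewrite oner_eq0.
have FG (c : 'cV[rat]_n) :
    \prod_l (if l \in D :\ a then c l 0 < 0 else 0 <= c l 0)%R%:R
    + \prod_l (if l \in D then c l 0 < 0 else 0 <= c l 0)%R%:R
    = \prod_(l | l != a) (if l \in D then c l 0 < 0 else 0 <= c l 0)%R%:R :> rat.
  rewrite (bigD1 a) //= [X in _ + X](bigD1 a) //= aD !inE eqxx /=.
  under eq_bigr => l la do rewrite !inE la /=.
  by rewrite -mulrDl -natrD; case: (lerP 0 (c a 0)) => _; rewrite mul1r.
move=> x c; rewrite !FG; apply: eq_bigr => l /negPf la.
by rewrite !mxE la mulr0 addr0.
Qed.

(** * Cells and their cones *)

(** With [X] and [Y] the positive and negative indices, this is the coordinate vector of [gamma];
    swapping [X] and [Y] gives that of [- gamma]. *)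
Definition signed_col (n : nat) (p : 'I_n -> rat) (X Y : {set 'I_n}) : 'cV[rat]_n :=
  \col_l (if l \in X then p l else if l \in Y then - p l else 0).

(** Strictness for [l < i] selects the first minimum over [X], so that ties are counted once.
    Swapping [X] and [Y] gives the second kind of cell. *)
Definition cell (n : nat) (p : 'I_n -> rat) (X Y : {set 'I_n}) (i : 'I_n)
    (c : 'cV[rat]_n) : bool :=
  let t l := c l 0 / p l in
  [forall l, if l == i then 0 <= t i
             else if l \in X then (if (l < i)%N then t i < t l else t i <= t l)
             else if l \in Y then 0 <= t l + t i
             else 0 <= c l 0].

(** With respect to the generators [B], the [i]-th coordinate is [t_i]; the [l]-th is
    [p_l (t_l - t_i)] for [l] in [X], negated if [l < i], then [p_l (t_l + t_i)] for [l] in [Y], and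
    [c_l] otherwise. Reversing the inequalities on the negated coordinates yields the cell. *)
Lemma cone_cell (R : realType) (d n : nat) (M : 'M[rat]_(d, n)) C
    (p : 'I_n -> rat) (X Y : {set 'I_n}) (i : 'I_n) (B : 'I_n -> 'cV[rat]_d) :
  C *m M = 1%:M -> [disjoint X & Y] ->
  (forall l, l \in X :|: Y -> 0 < p l) -> i \in X ->
  (forall l, B l = if l == i then M *m signed_col p X Y
                   else if (l \in X) && (l < i)%N then - col l M
                   else col l M) ->
  series_represents (coord_series M C (fun c => (cell p X Y i c)%:R))
    ((-1) ^+ #|[set l in X | (l < i)%N]| * sigma (cone R B)).
Proof.
move=> CM XY p0 iX BE.
set D := [set l in X | (l < i)%N]; set h := signed_col p X Y in BE *.
have hi : h i 0 = p i by rewrite mxE iX.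
have pi0 : 0 < p i by rewrite p0 // inE iX.
pose e l : rat := if l \in D then -1 else 1.
have ee l : e l * e l = 1 by rewrite /e; case: ifP; rewrite ?mulrNN mulr1.
(* [T] holds the generators [B] in terms of the columns of [M], and [U] is its inverse. *)
pose T : 'M[rat]_n :=
  \matrix_(l', l) if l == i then h l' 0 else e l * (l' == l)%:R.
pose U : 'M[rat]_n := \matrix_(l, m) if l == i then (m == i)%:R / p i
  else e l * ((m == l)%:R - h l 0 / p i * (m == i)%:R).
have sum_delta q (A : 'M[rat]_(n, q)) l j : \sum_m (m == l)%:R * A m j = A l j.
  rewrite (bigD1 l) //= eqxx mul1r big1 ?addr0 // => m /negPf ->.
  by rewrite mul0r.
have UE q (A : 'M[rat]_(n, q)) l j : (U *m A) l j =
    if l == i then A i j / p i else e l * (A l j - h l 0 / p i * A i j).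
  rewrite mxE; under eq_bigr do rewrite mxE; case: eqP => _.
    by under eq_bigr do rewrite mulrAC; rewrite -mulr_suml sum_delta.
  under eq_bigr do rewrite -mulrA mulrBl -[_ / _ * _ * _]mulrA.
  by rewrite -mulr_sumr sumrB -mulr_sumr !sum_delta.
have pi_neq0 := lt0r_neq0 pi0.
have UT : U *m T = 1%:M.
  apply/matrixP => l m; rewrite UE !mxE -/h.
  have [->|li] := eqVneq l i; have [mi|mi] := eqVneq m i.
  - by rewrite iX divff.
  - by rewrite mulr0 mul0r.
  - by rewrite mi (negPf li) iX divfK // subrr mulr0.
  rewrite !mulr0 subr0 mulrA.
  by case: eqVneq => [->|_]; rewrite ?ee ?mulr0 ?mul1r.
have TU := mulmx1C UT.
have CM' : (U *m C) *m (M *m T) = 1%:M.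
  by rewrite mulmxA -[U *m C *m M]mulmxA CM mulmx1.
have BT l : B l = col l (M *m T).
  rewrite BE [in RHS]colE -mulmxA -[T *m _]colE; case: eqP => [->|/eqP li].
    by congr (_ *m _); apply/matrixP => l' j; rewrite (ord1 j) [RHS]mxE [RHS]mxE eqxx.
  have -> : col l T = e l *: delta_mx l 0.
    by apply/matrixP => l' j; rewrite (ord1 j) !mxE (negPf li) eqxx andbT.
  rewrite -scalemxAr -colE /e inE.
  by case: ifP => _; rewrite ?scaleN1r ?scale1r.
have [f Ff] := series_represents_orthant CM'.
(* The cone does represent a rational function, so the default value of [sigma] is excluded. *)
have -> : sigma (cone R B) = f.
  apply: sigma_eq; apply: series_represents_ext Ff => m.
  by rewrite (lattice_series_cone R BT CM').
apply: series_represents_ext (series_represents_flip_orthant D CM' Ff) => m.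
rewrite coord_series_basis //; apply: coord_series_ext => {m} c.
rewrite prodr_bool; congr (nat_of_bool _)%:R; apply: eq_forallb => l /=.
rewrite UE /e inE [h l 0]mxE; case: eqVneq => [->|li].
  by rewrite ltnn andbF.
have [lX|lX] := boolP (l \in X).
  have pl : 0 < p l by rewrite p0 // inE lX.
  have -> : p l / p i * c i 0 = c i 0 / p i * p l by ring.
  case: ltnP => _ /=; first by rewrite mulN1r oppr_lt0 subr_gt0 ltr_pdivlMr.
  by rewrite mul1r subr_ge0 ler_pdivlMr.
rewrite mul1r; have [lY|lY] := boolP (l \in Y); last by rewrite !mul0r subr0.
have pl : 0 < p l by rewrite p0 // inE lY orbT.
rewrite -[in RHS](pmulr_rge0 _ pl); congr (_ <= _).
by field; rewrite pi_neq0 lt0r_neq0.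
Qed.

(** * Counting cells by first minima *)

(** The smallest index [a] at which [t] is minimal over [X] is the only one that passes the test, so
    the sum has a single surviving term. *)
Lemma first_argmin (n : nat) (t : 'I_n -> rat) (X : {set 'I_n}) :
  X != finset.set0 ->
  exists a, [/\ a \in X, forall l, l \in X -> t a <= t l
    & forall Q : pred 'I_n,
      \sum_(i in X)
        ([forall (l | l \in X),
            (l != i) ==> if (l < i)%N then t i < t l else t i <= t l]
         && Q i)%:R = (Q a)%:R :> rat].
Proof.
case/finset.set0Pn=> a0 a0X; case: (arg_minP t a0X) => b bX bmin.
pose P := [pred l in X | t l == t b].
have Pb : P b by apply/andP; split.
case: (arg_minnP (fun l : 'I_n => l : nat) Pb) => a /andP[aX /eqP ab] amin.
have ta l : l \in X -> t a <= t l by move=> /bmin; rewrite ab.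
have ta_lt l : l \in X -> (l < a)%N -> t a < t l.
  move=> lX la; rewrite lt_neqAle ta // andbT ab eq_sym.
  by apply: contraL la => lb; rewrite -leqNgt amin //= lX.
exists a; split=> // Q; rewrite (bigD1 a) //=.
rewrite (_ : [forall (l | _), _]); last first.
  apply/forall_inP => l lX; apply/implyP => _.
  by case: ifP => [/ta_lt|_]; [apply | exact: ta].
(* Any other [i] fails its comparison with [a]: minimality refutes it if [a < i], and the choice of
   the first minimum if [i < a]. *)
rewrite big1 ?addr0 // => i /andP[iX ia].
case: forall_inP => // /(_ a aX); rewrite eq_sym ia /=.
case: ltngtP => [_|/(ta_lt i iX) it|/val_inj ai].
- by rewrite ltNge ta.
- by rewrite leNgt it.
by rewrite ai eqxx in ia.
Qed.

(* Both sums count the index of the first minimum of the scaled coordinates over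
   [X], resp. [Y]; the negative term is invariant under translation by
   [signed_col p X Y]. *)
Lemma sum_cells (n : nat) (p : 'I_n -> rat) (X Y : {set 'I_n}) (c : 'cV[rat]_n) :
  [disjoint X & Y] -> (forall l, l \in X :|: Y -> 0 < p l) ->
  X :|: Y != finset.set0 ->
  orthant c =
    \sum_(i in X) (cell p X Y i c)%:R + \sum_(j in Y) (cell p Y X j c)%:R
    - [&& X != finset.set0, Y != finset.set0,
          [forall (l | l \in X), forall (l' | l' \in Y),
             0 <= c l 0 / p l + c l' 0 / p l'] &
          [forall (l | l \notin X :|: Y), 0 <= c l 0]]%:R.
Proof.
move=> XY p0 XY0; pose t l := c l 0 / p l.
set z := [forall (l | l \notin X :|: Y), 0 <= c l 0].
have t0 l : l \in X :|: Y -> (0 <= c l 0) = (0 <= t l).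
  by move=> /p0 pl; rewrite /t pmulr_lge0 // invr_gt0.
(* The first conjunct is the test of [first_argmin]; the others form its predicate [Q]. *)
have cellE (X' Y' : {set 'I_n}) i : [disjoint X' & Y'] -> X' :|: Y' = X :|: Y ->
    i \in X' -> cell p X' Y' i c =
    [forall (l | l \in X'),
        (l != i) ==> if (l < i)%N then t i < t l else t i <= t l]
    && [&& 0 <= t i, [forall (l | l \in Y'), 0 <= t l + t i] & z].
  move=> dXY eXY iX'; apply/forallP/and4P => [cl|[/forall_inP h1 h2]].
    split.
    - apply/forall_inP => l lX; apply/implyP => /negPf li.
      by have := cl l; rewrite li lX.
    - by have := cl i; rewrite eqxx.
    - apply/forall_inP => l lY.
      have lX : l \in X' = false.
        by apply/negP => lX; have/pred0P/(_ l) := dXY; rewrite /= lX lY.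
      have li : l == i = false by apply/eqP => li; rewrite li iX' in lX.
      by have := cl l; rewrite lX li lY.
    apply/forall_inP => l; rewrite -eXY inE negb_or => /andP[lX lY].
    have li : l == i = false by apply/eqP => li; rewrite li iX' in lX.
    by have := cl l; rewrite li (negPf lX) (negPf lY).
  move=> /forall_inP h3 /forall_inP h4 l; case: (eqVneq l i) => [//|li].
  have [lX|lX] := boolP (l \in X'); first by have := h1 l lX; rewrite li.
  have [lY|lY] := boolP (l \in Y'); first exact: h3.
  by apply: h4; rewrite -eXY inE negb_or lX.
have orthE : orthant c =
    [&& [forall (l | l \in X), 0 <= t l],
        [forall (l | l \in Y), 0 <= t l] & z]%:R.
  rewrite /orthant prodr_bool; congr (nat_of_bool _)%:R.
  apply/forall_inP/and3P => [c0|[/forall_inP h1 /forall_inP h2 /forall_inP h3] l _].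
    split; apply/forall_inP => l lX; last exact: c0.
      by rewrite -t0 ?c0 // inE lX.
    by rewrite -t0 ?c0 // inE lX orbT.
  have [|/h3//] := boolP (l \in X :|: Y).
  by move=> lXY; rewrite t0 //; move: lXY; rewrite inE => /orP[/h1|/h2].
have minE (W : {set 'I_n}) a x : a \in W -> (forall l, l \in W -> t a <= t l) ->
    [forall (l | l \in W), 0 <= t l + x] = (0 <= t a + x).
  move=> aW amin; apply/forall_inP/idP => [/(_ a aW)//|ax l /amin al].
  by rewrite (le_trans ax) // lerD2r.
have minE0 (W : {set 'I_n}) a : a \in W -> (forall l, l \in W -> t a <= t l) ->
    [forall (l | l \in W), 0 <= t l] = (0 <= t a).
  move=> aW /(minE W a 0 aW); rewrite addr0 => <-.
  by apply: eq_forallb => l; rewrite addr0.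
have YX : [disjoint Y & X] by rewrite disjoint_sym.
rewrite orthE.
under eq_bigr => i iX do rewrite cellE //.
under [X in _ + X - _]eq_bigr => i iY do rewrite (cellE Y X) // 1?finset.setUC //.
have set0E (b : pred 'I_n) : [forall (l | l \in finset.set0), b l].
  by apply/forall_inP => l; rewrite inE.
have [X0|X0] := eqVneq X finset.set0.
  have Y0 : Y != finset.set0 by move: XY0; rewrite X0 finset.set0U.
  have [b [bY bmin ->]] := first_argmin t Y0.
  by rewrite X0 big_set0 add0r subr0 (minE0 Y b) // !set0E.
have [a [aX amin ->]] := first_argmin t X0.
have [Y0|Y0] := eqVneq Y finset.set0.
  by rewrite Y0 big_set0 addr0 subr0 (minE0 X a) // !set0E.
have [b [bY bmin ->]] := first_argmin t Y0.
rewrite (minE0 X a) // (minE0 Y b) //=.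
have -> : [forall (l | l \in X), forall (l' | l' \in Y),
             0 <= c l 0 / p l + c l' 0 / p l'] = (0 <= t a + t b).
  rewrite -(minE X a) //; apply: eq_forallb_in => l lX.
  by rewrite addrC -(minE Y b) //; apply: eq_forallb_in => l' l'Y; rewrite addrC.
rewrite (minE Y b) // (minE X a) // [t b + _]addrC; case: (z); rewrite ?andbF // !andbT.
(* With [m = t a] and [m' = t b], the identity is [[m >= 0][m' >= 0] = ([m >= 0] + [m' >= 0] - 1)
   [m + m' >= 0]]. *)
by case: (lerP 0 (t a)); case: (lerP 0 (t b)); case: (lerP 0 (t a + t b)) => //=; lra.
Qed.

(** * Assembly of the identity *)

(** Linear independence enters the proof through this matrix, which reads off coordinates with
    respect to [alpha]. *)
Lemma free_left_inverse (d n : nat) (alpha : 'I_n -> 'cV[rat]_d) :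
  free [tuple alpha i | i < n] ->
  exists C, C *m (\matrix_(j, l) alpha l j 0) = 1%:M :> 'M_n.
Proof.
move=> /freeP fr; set M := \matrix_(j, l) _.
have /row_freeP[C MC] : row_free M^T.
  apply: inj_row_free => v vM; apply/rowP => l; rewrite mxE; move: l.
  apply: fr; apply/matrixP => j k; rewrite (ord1 k) summxE mxE.
  have := congr1 (fun x : 'rV_d => x 0 j) vM; rewrite !mxE => vj.
  rewrite -[RHS]vj; apply: eq_bigr => l _.
  by rewrite -tnth_nth tnth_mktuple !mxE.
exists C^T; apply: trmx_inj.
by rewrite trmx_mul trmxK MC trmx1.
Qed.

(** Turns the number of reversed generators into the exponents [i] and [j - k]. *)
Lemma card_ord_interval (n a b : nat) :
  (b <= n)%N -> #|[set l : 'I_n | (a <= l < b)%N]| = (b - a)%N.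
Proof.
move=> bn; rewrite cardsE -sum1_card -[RHS]muln1 -sum_nat_const_nat.
by rewrite (big_nat_widenl _ 0) // (big_nat_widen _ _ _ _ _ bn) big_mkord.
Qed.

Theorem theorem3p1 (R : realType) (d n : nat) (alpha : 'I_n -> 'cV[rat]_d)
    (halpha : free [tuple alpha i | i < n])
    (r k : nat) (hr1 : (1 <= r)%N) (hrn : (r <= n)%N) (hkr : (k <= r)%N)
    (p : 'I_n -> rat) (hp : forall i : 'I_n, (i < r)%N -> 0 < p i) :
  let g := gamma alpha p k r in
  sigma (cone R alpha) =
    \sum_(i < n | (i < k)%N)
       (-1) ^+ i * sigma (cone R (A_pos alpha g i))
    + \sum_(j < n | (k <= j < r)%N)
       (-1) ^+ (j - k) * sigma (cone R (A_neg alpha g k j)).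
Proof.
move=> g; have [C CM] := free_left_inverse halpha; set M := \matrix_(j, l) _ in CM.
have alphaE l : alpha l = col l M by apply/matrixP => j q; rewrite (ord1 q) !mxE.
pose X : {set 'I_n} := [set l : 'I_n | (l < k)%N].
pose Y : {set 'I_n} := [set l : 'I_n | (k <= l < r)%N].
have XY : [disjoint X & Y].
  by apply/pred0P => l /=; rewrite !inE ltnNge; case: (k <= l)%N.
have YX : [disjoint Y & X] by rewrite disjoint_sym.
have p0 l : l \in X :|: Y -> 0 < p l.
  rewrite !inE => /orP[lk|/andP[_ lr]]; apply: hp => //.
  exact: leq_trans lk hkr.
have p0' l : l \in Y :|: X -> 0 < p l by rewrite finset.setUC; apply: p0.
have XY0 : X :|: Y != finset.set0.
  apply/finset.set0Pn; exists (Ordinal (leq_trans hr1 hrn)).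
  by rewrite !inE /= hr1 andbT; case: (k).
have gE : g = M *m signed_col p X Y.
  apply/matrixP => j q; rewrite (ord1 q) !mxE !summxE.
  rewrite (big_mkcond (fun i : 'I_n => (i < k)%N)).
  rewrite (big_mkcond (fun i : 'I_n => (k <= i < r)%N)) -sumrB.
  apply: eq_bigr => l _; rewrite !mxE !inE.
  by case: ltnP => _ /=; [rewrite subr0 mulrC | case: ifP => _;
    rewrite ?mxE ?sub0r ?subr0 ?mulrN ?mulr0 // mulrC].
(* Hence [cone_cell] also covers the matrices [A_neg], with [X] and [Y] swapped. *)
have gNE : - g = M *m signed_col p Y X.
  rewrite gE -mulmxN; congr (_ *m _); apply/matrixP => l q; rewrite !mxE !inE.
  by rewrite ltnNge; case: (k <= l)%N; case: (l < r)%N; rewrite /= ?opprK ?oppr0.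
pose L (c : 'cV[rat]_n) := [&& X != finset.set0, Y != finset.set0,
    [forall (l | l \in X), forall (l' | l' \in Y),
      0 <= c l 0 / p l + c l' 0 / p l']
  & [forall (l | l \notin X :|: Y), 0 <= c l 0]].
have w0 : signed_col p X Y != 0.
  have [l lXY] := finset.set0Pn _ XY0.
  apply: contraTneq (p0 l lXY) => /matrixP/(_ l 0); rewrite !mxE.
  move: lXY; rewrite inE; case: (l \in X) => /= [_ ->|->]; first by rewrite ltxx.
  by move/eqP; rewrite oppr_eq0 => /eqP ->; rewrite ltxx.
(* Adding [x] times [gamma] raises [t_l] by [x] on [X] and lowers it by [x] on [Y], so the sums
   [t_l + t_l'] are unchanged. *)
have Lper x c : (L (c + x *: signed_col p X Y))%:R = (L c)%:R :> rat.
  congr (nat_of_bool _)%:R; congr [&& _, _, _ & _].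
    apply: eq_forallb_in => l lX; apply: eq_forallb_in => l' lY.
    have lX' : l' \in X = false.
      by apply/negP => lX'; have/pred0P/(_ l') := XY; rewrite /= lX' lY.
    have pl := lt0r_neq0 (p0 l _); have pl' := lt0r_neq0 (p0 l' _).
    rewrite !mxE lX lX' lY; congr (_ <= _).
    by field; rewrite pl ?pl' // inE ?lX ?lY ?orbT.
  apply: eq_forallb_in => l; rewrite inE negb_or => /andP[/negPf lX /negPf lY].
  by rewrite !mxE lX lY mulr0 addr0.
apply: sigma_eq.
have HX (i : 'I_n) : (i < k)%N -> series_represents
    (coord_series M C (fun c => (cell p X Y i c)%:R))
    ((-1) ^+ i * sigma (cone R (A_pos alpha g i))).
  move=> ik; rewrite -[X in _ ^+ X]subn0 -(card_ord_interval 0 (ltnW (ltn_ord i))).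
  have -> : [set l : 'I_n | (0 <= l < i)%N] = [set l in X | (l < i)%N].
    by apply/setP => l; rewrite !inE; case: ltnP => li; rewrite ?andbF // (ltn_trans li).
  apply: cone_cell => //; first by rewrite inE.
  move=> l; rewrite /A_pos -gE -alphaE inE.
  case: (eqVneq l i) => [->|_]; first by rewrite ltnn.
  by case: ltnP => li; rewrite ?andbF // (ltn_trans li).
have HY (j : 'I_n) : (k <= j < r)%N -> series_represents
    (coord_series M C (fun c => (cell p Y X j c)%:R))
    ((-1) ^+ (j - k) * sigma (cone R (A_neg alpha g k j))).
  move=> /andP[kj jr]; rewrite -(card_ord_interval k (ltnW (ltn_ord j))).
  have -> : [set l : 'I_n | (k <= l < j)%N] = [set l in Y | (l < j)%N].
    apply/setP => l; rewrite !inE; case: (ltnP l j) => lj; rewrite ?andbF //.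
    by rewrite (ltn_trans lj jr) !andbT.
  apply: cone_cell => //; first by rewrite inE kj.
  move=> l; rewrite /A_neg -gNE -alphaE inE.
  case: (eqVneq l j) => [->|_]; first by rewrite ltnNge kj ltnn.
  case: ltnP => lk //=; case: ltnP => lj; rewrite ?andbF //.
  by rewrite (ltn_trans lj jr).
have /series_representsN := coord_series_period CM w0 Lper; rewrite oppr0 => HL.
have := series_representsD (series_representsD
  (series_represents_sum (index_enum 'I_n) HX)
  (series_represents_sum (index_enum 'I_n) HY)) HL.
rewrite addr0; apply: series_represents_ext => m.
(* Both sides are now series in the coordinates with respect to [alpha], where the cone [K] is the
   orthant and [sum_cells] compares them pointwise. *)
rewrite (lattice_series_cone R alphaE CM) -coord_seriesN -!coord_series_sum.
rewrite -!coord_seriesD; apply: coord_series_ext => {m} c.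
rewrite (sum_cells c XY p0 XY0); congr (_ + _ - _).
  by apply: eq_bigl => i; rewrite inE.
by apply: eq_bigl => i; rewrite inE.
Qed.
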